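(* Let $\rho$ be a representation of a group $G$ in a space $V$, let $U$ be a space, and let $F: V\to U$ be an operator (not required to be linear). Let $\mathcal{W}: V\to L(G,U)$ be the covariant transform, $[\mathcal{W}v](g)=F(\rho(g^{-1})v)$ for $v\in V$, $g\in G$. Then $\mathcal{W}$ intertwines $\rho$ and the left regular representation $\Lambda$ of $G$ on $L(G,U)$, that is, $\mathcal{W}(\rho(g)v)=\Lambda(g)(\mathcal{W}v)$ for all $g\in G$ and $v\in V$.
   Context: ''Space'' means a (real or complex) vector space, and a representation $\rho$ of $G$ in $V$ is a homomorphism from $G$ to the invertible linear operators on $V$. An ''operator'' $F:V\to U$ is an arbitrary map, not necessarily linear. $L(G,U)$ denotes the space of $U$-valued functions on $G$. The left regular representation $\Lambda$ of $G$ on $L(G,U)$ is given by $[\Lambda(g)f](h)=f(g^{-1}h)$ for $g,h\in G$, $f\in L(G,U)$. *)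

(* Defs.v *)
From HB Require Import structures.
From mathcomp Require Import all_boot all_algebra.
From mathcomp Require Import boolp functions reals complex.
Set Implicit Arguments.
Unset Strict Implicit.
Unset Printing Implicit Defensive.
Import GRing.Theory.
Local Open Scope group_scope.

(* A "space" is a vector space over [scalars R k] for one of the two kinds [k],
   where [R : realType] is the field of real numbers. *)
Variant scalar_kind := RealScalars | ComplexScalars.

Definition scalars (R : realType) (k : scalar_kind) : fieldType :=
  match k with
  | RealScalars => R
  | ComplexScalars => R[i]
  end.

(* Invertible linear operators.  The inverse is stored as data, but it adds
   nothing to [gl_fun]: see [gl_ext] for uniqueness, [gl_inv_linear] for
   linearity. *)
Record GL (K : fieldType) (V : lmodType K) := MkGL {
  gl_fun :> V -> V;
  gl_inv : V -> V;
  gl_linear : linear gl_fun;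
  gl_funK : cancel gl_fun gl_inv;
  gl_invK : cancel gl_inv gl_fun
}.

HB.instance Definition _ (K : fieldType) (V : lmodType K) (f : GL V) :=
  GRing.isLinear.Build K V V _ (gl_fun f) (gl_linear f).

HB.instance Definition _ (K : fieldType) (V : lmodType K) :=
  gen_eqMixin (GL V).
HB.instance Definition _ (K : fieldType) (V : lmodType K) :=
  gen_choiceMixin (GL V).

Section GLGroup.
Variables (K : fieldType) (V : lmodType K).
Implicit Types f g h : GL V.

Lemma gl_ext f g : f =1 g -> f = g.
Proof.
case: f g => [f f' lf fK f'K] [g g' lg gK g'K] /= /funext efg.
subst g; have ef : f' = g'.
  by apply/funext => x; apply: (can_inj fK); rewrite f'K g'K.
subst g'; congr MkGL; exact: Prop_irrelevance.
Qed.

Fact gl_one_linear : linear (fun v : V => v). Proof. by []. Qed.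

Definition gl_one : GL V :=
  MkGL gl_one_linear (fun=> erefl) (fun=> erefl).

Fact gl_mul_linear f g : linear (f \o g).
Proof. by move=> a u v /=; rewrite !linearP. Qed.

Definition gl_mul f g : GL V :=
  MkGL (gl_mul_linear f g)
       (can_comp (@gl_funK _ _ f) (@gl_funK _ _ g))
       (can_comp (@gl_invK _ _ g) (@gl_invK _ _ f)).

Fact gl_inv_linear f : linear (gl_inv f).
Proof.
move=> a u v; apply: (can_inj (@gl_funK _ _ f)).
by rewrite linearP /= !gl_invK.
Qed.

Definition gl_invg f : GL V :=
  MkGL (gl_inv_linear f) (@gl_invK _ _ f) (@gl_funK _ _ f).

Fact gl_mulA : associative gl_mul. Proof. by move=> f g h; exact: gl_ext. Qed.
Fact gl_mul1 : left_id gl_one gl_mul. Proof. by move=> f; exact: gl_ext. Qed.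
Fact gl_mulr1 : right_id gl_one gl_mul. Proof. by move=> f; exact: gl_ext. Qed.
Fact gl_mulV : left_inverse gl_one gl_invg gl_mul.
Proof. by move=> f; apply: gl_ext; exact: gl_funK. Qed.
Fact gl_mulrV : right_inverse gl_one gl_invg gl_mul.
Proof. by move=> f; apply: gl_ext; exact: gl_invK. Qed.

HB.instance Definition _ := isGroup.Build (GL V)
  gl_mulA gl_mul1 gl_mulr1 gl_mulV gl_mulrV.

End GLGroup.

(* [GL V] is a group, so multiplicativity alone makes this a group
   homomorphism (it forces [rho 1 = 1]). *)
Notation representation G V := {multiplicative G -> GL V}.

Section LeftRegular.
Variables (K : fieldType) (G : groupType) (U : lmodType K).

Definition left_translation (g : G) (f : G -> U) : G -> U :=
  fun h => f (g^-1 * h).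

Fact left_translation_linear g : linear (left_translation g).
Proof. by []. Qed.

Fact left_translationK g :
  cancel (left_translation g) (left_translation g^-1).
Proof.
by move=> f; apply/funext => h; rewrite /left_translation invgK mulKg.
Qed.

Fact left_translationVK g :
  cancel (left_translation g^-1) (left_translation g).
Proof.
by move=> f; apply/funext => h; rewrite /left_translation invgK mulVKg.
Qed.

Definition left_regular (g : G) : GL (G -> U) :=
  MkGL (left_translation_linear g)
       (left_translationK g) (left_translationVK g).

Fact left_regularM : {morph left_regular : g h / g * h}.
Proof.
move=> g h; apply: gl_ext => f; apply/funext => x.
by rewrite /= /left_translation invgM mulgA.
Qed.

HB.instance Definition _ :=
  isMultiplicative.Build G (GL (G -> U)) left_regular left_regularM.

End LeftRegular.

Arguments left_regular {K} G U g.

Definition covariant_transform (K : fieldType) (G : groupType)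
    (V : lmodType K) (U : Type) (rho : representation G V) (F : V -> U)
    (v : V) : G -> U :=
  fun g => F (rho g^-1 v).

Definition intertwines (K K' : fieldType) (G : groupType)
    (V : lmodType K) (W : lmodType K') (T : V -> W)
    (rho : representation G V) (sigma : representation G W) : Prop :=
  forall (g : G) (v : V), T (rho g v) = sigma g (T v).

(* Main.v *)
Require Import Defs.
From HB Require Import structures.
From mathcomp Require Import all_boot all_algebra.
From mathcomp Require Import boolp functions reals complex.

Theorem theorem1 (R : realType) (kV kU : scalar_kind) (G : groupType)
  (V : lmodType (scalars R kV)) (U : lmodType (scalars R kU))
  (rho : representation G V) (F : V -> U) :
  intertwines (covariant_transform rho F) rho (left_regular G U).
Proof.
move=> g v; apply/funext => h.
rewrite /covariant_transform /= /left_translation.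
(* It remains to compare the points at which [F] is evaluated: they agree
   because (g^-1 h)^-1 = h^-1 g and [rho] is multiplicative. *)
by rewrite invgM invgK gmulfM.
Qed.
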